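(* Let $\gamma\in\mathbb{R}$ and let $B=(\overline{\beta_1,\dots,\beta_n})$ be an alternate base of real numbers with $\lim_{m\to\infty}|B[m]|=\infty$. Let $i\in\{1,\dots,n\}$, let $K_i:=\mathbb{Q}(\beta_1,\dots,\beta_{i-1},\beta_{i+1},\dots,\beta_n)$, and let $x\in K_i\cap[\gamma,\gamma+1]$. If $d(B;x)$ or $d^*(B;x)$ (the latter when $x=\gamma+1$) is eventually periodic and $T^{i-1}(x)\ne0$, then $\beta_i$ is algebraic over $K_i$.
   Context: Let $B=(\overline{\beta_1,\dots,\beta_n})$ denote the purely periodic sequence $(\beta_m)_{m\ge1}$ with $\beta_{m+n}=\beta_m$ (an alternate base), and $B[m]=\prod_{j=1}^m\beta_j$, $B[0]=1$. For $x\in[\gamma,\gamma+1)$ put $T^0(x)=x$ and, for $m\ge1$, $a_m(x)=\lfloor \beta_m T^{m-1}(x)-\gamma\rfloor$ and $T^m(x)=\beta_mT^{m-1}(x)-a_m(x)\in[\gamma,\gamma+1)$. For $x=\gamma+1$ the same formulas are used, starting from $T^0(\gamma+1)=\gamma+1$, $a_1(\gamma+1)=\lfloor\beta_1(\gamma+1)-\gamma\rfloor$, $T^1(\gamma+1)=\beta_1(\gamma+1)-a_1(\gamma+1)\in[\gamma,\gamma+1)$. The $B$-expansion of $x$ is $d(B;x)=(a_1(x),a_2(x),\dots)$. Also $d^*(B;\gamma+1):=\lim_{\varepsilon\to0^+}d(B;\gamma+1-\varepsilon)$ (digitwise limit). If $d(B;x)$, or $d^*(B;x)$ with $x=\gamma+1$,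 equals $(d_1,d_2,\dots)$, then $x=\sum_{m\ge1}d_m/B[m]$.
   Formalization: In the d* case, ''T^{i-1}(x) ≠ 0'' is replaced by ''lim_{ε→0+} T^{i-1}(γ+1−ε) ≠ 0''; with the literal condition the claim fails, e.g. γ = −1, B = (2,π), i = 2, x = 0, where d*(B;0) = (0,0,…) and T(0) = −1. *)

(* Defs.v *)
From HB Require Import structures.
From mathcomp Require Import all_boot all_order all_algebra.
From mathcomp Require Import all_classical all_reals all_analysis.

Set Implicit Arguments.
Unset Strict Implicit.
Unset Printing Implicit Defensive.

Import Order.TTheory GRing.Theory Num.Theory.
Import numFieldNormedType.Exports.

Local Open Scope classical_set_scope.
Local Open Scope ring_scope.

(* Bases and digit sequences are indexed from 1, as functions on nat whose
   value at 0 is never relevant. *)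

Definition alternate_base (R : realType) (n : nat) (beta : nat -> R) : Prop :=
  forall m : nat, (0 < m)%N -> beta (m + n)%N = beta m.

Definition base_prod (R : realType) (beta : nat -> R) (m : nat) : R :=
  \prod_(1 <= j < m.+1) beta j.

(* T^m(x); the recursion is also used at the endpoint x = gamma + 1. *)
Fixpoint remainder (R : realType) (gamma : R) (beta : nat -> R) (x : R)
    (m : nat) : R :=
  if m is k.+1 then
    let y := beta k.+1 * remainder gamma beta x k in
    y - (Num.floor (y - gamma))%:~R
  else x.

(* a_m(x), for m >= 1; the sequence [digit gamma beta x] is d(B;x). *)
Definition digit (R : realType) (gamma : R) (beta : nat -> R) (x : R)
    (m : nat) : int :=
  Num.floor (beta m * remainder gamma beta x m.-1 - gamma).

(* d^*(B;gamma+1). As int carries no topology in the library, the integer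
   digits are embedded in R before the limit is taken. *)
Definition digit_star (R : realType) (gamma : R) (beta : nat -> R)
    (m : nat) : R :=
  lim (((digit gamma beta (gamma + 1 - e) m)%:~R : R) @[e --> (0 : R)^'+]).

(* The remainders that belong to d^*(B;gamma+1):
     digit_star m = beta m * remainder_star m.-1 - remainder_star m,
   whereas T^m(gamma+1) belongs to d(B;gamma+1). The two may differ: for
   gamma = -1 and B = (2, pi) one has d^*(B;0) = (0, 0, 0, ...), all whose
   remainders are 0, but T(0) = -1. *)
Definition remainder_star (R : realType) (gamma : R) (beta : nat -> R)
    (m : nat) : R :=
  lim (remainder gamma beta (gamma + 1 - e) m @[e --> (0 : R)^'+]).

Definition eventually_periodic (T : Type) (d : nat -> T) : Prop :=
  exists2 p : nat, (0 < p)%N & \forall m \near \oo, d (m + p)%N = d m.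

Definition generated_subfield (R : realType) (G : set R) : set R :=
  smallest (fun K : set R => divring_closed (mem K)) G.

Definition base_field (R : realType) (n : nat) (beta : nat -> R) (i : nat) :
    set R :=
  generated_subfield [set beta j | j in [set j | (1 <= j <= n)%N && (j != i)]].

Definition algebraic_over (R : realType) (K : set R) (y : R) : Prop :=
  exists2 p : {poly R}, p != 0 & p \is a polyOver (mem K) /\ root p y.

(* Main.v *)
Require Import Defs.
From HB Require Import structures.
From mathcomp Require Import all_boot all_order all_algebra.
From mathcomp Require Import all_classical all_reals all_analysis.
From mathcomp Require Import ring lra.
Import Order.TTheory GRing.Theory Num.Theory.
Import numFieldNormedType.Exports.
Local Open Scope classical_set_scope.
Local Open Scope ring_scope.

(** Let [K] be the base field, [d] the digits of the expansion and [r] its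
remainders, so that [r 0 = x] and [r m = beta m * r (m - 1) - d m]. All [beta m]
lie in [K], except possibly those with [m] congruent to [i] modulo [n], which
equal [beta i]. Replacing [beta i] by an indeterminate in the recurrence gives
polynomials [F m] over [K] ([remainder_poly]) whose values at [beta i] are the
remainders. The remainder [r (i - 1)] is a nonzero constant, so [F i] has degree
one; from then on the degree is unchanged by a step, unless it is a
multiplication by the indeterminate, and these raise the degree once in every
period of the base ([size_remainder_polyS]).

If the digits are eventually periodic, choose a common period [P] of digits and
base. For large [m] the differences [r (m + P) - r m] satisfy the homogeneous
recurrence [e m = beta m * e (m - 1)]. They are bounded because all remainders
lie in [[gamma, gamma + 1]], while the products of the [beta m] are unbounded;
hence they vanish ([bounded_linear_orbit_eq0]). So [F (m + P) - F m] has the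
root [beta i], and it is nonzero because the two degrees differ
([algebraic_of_periodic_digits]).

This argument uses only the recurrence and the boundedness of the remainders,
and it remains to see that the left limits at [gamma + 1] have these properties.
For small [e > 0] the first [m] digits of [gamma + 1 - e] are independent of [e],
so that the [m]-th remainder is an affine function of [e]
([remainder_star_near]) and the recurrence passes to the limit
([remainder_starS]). *)

(** * Subfields as closed predicates *)

(** A named predicate, because a closure structure can only be attached to a
head constant. *)
Definition generated_subfield_pred (R : realType) (G : set R) : {pred R} :=
  mem (generated_subfield G).

Lemma generated_subfield_closed (R : realType) (G : set R) :
  divring_closed (generated_subfield_pred R G).
Proof.
split.
- by rewrite inE => K [[K1 _ _] _]; move: K1; rewrite inE.
- move=> u v; rewrite !inE => uG vG K KG.
  have [[_ KB _] _] := KG.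
  by have := KB u v; rewrite !inE; apply; [exact: uG|exact: vG].
- move=> u v; rewrite !inE => uG vG K KG.
  have [[_ _ KV] _] := KG.
  by have := KV u v; rewrite !inE; apply; [exact: uG|exact: vG].
Qed.

HB.instance Definition _ (R : realType) (G : set R) :=
  GRing.isDivringClosed.Build R (generated_subfield_pred R G)
    (generated_subfield_closed R G).

(** * Remainders as polynomials in one base element *)

Lemma alternate_base_modn (R : realType) (n : nat) (beta : nat -> R) (k : nat) :
  alternate_base n beta -> beta k.+1 = beta (k %% n).+1.
Proof.
move=> hB; rewrite [in LHS](divn_eq k n) addnC -addSn.
elim: (k %/ n)%N => [|q IHq]; first by rewrite mul0n addn0.
by rewrite mulSn [(n + _)%N]addnC addnA hB.
Qed.

Lemma base_in_base_field (R : realType) (n : nat) (beta : nat -> R)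
    (i k : nat) :
  alternate_base n beta -> (0 < n)%N -> (k %% n).+1 != i ->
  beta k.+1 \in base_field n beta i.
Proof.
move=> hB n0 ki; rewrite (alternate_base_modn _ _ _ _ hB) inE.
by apply: sub_gen_smallest; exists (k %% n).+1 => //=; rewrite ltn_mod n0 ki.
Qed.

(** The recurrence of the remainders, with an indeterminate in place of
[beta i]. Step [k.+1] uses [beta k.+1 = beta (k %% n).+1]; the shift by one
keeps the representatives of the residues in [1..n], as for [i]. *)
Fixpoint remainder_poly (R : realType) (n : nat) (beta : nat -> R) (i : nat)
    (x : R) (d : nat -> R) (m : nat) : {poly R} :=
  if m is k.+1 then
    (if (k %% n).+1 == i then 'X else (beta k.+1)%:P)
      * remainder_poly R n beta i x d k - (d k.+1)%:P
  else x%:P.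

Lemma horner_remainder_poly (R : realType) (n : nat) (beta : nat -> R)
    (i : nat) (d r : nat -> R) (m : nat) :
  alternate_base n beta ->
  (forall k, r k.+1 = beta k.+1 * r k - d k.+1) ->
  (remainder_poly R n beta i (r 0%N) d m).[beta i] = r m.
Proof.
move=> hB hr; elim: m => [|k IHk] /=; first by rewrite hornerC.
rewrite hornerD hornerN hornerM hornerC IHk hr; congr (_ * _ - _).
case: eqP => [ki|_]; last by rewrite hornerC.
by rewrite hornerX (alternate_base_modn _ _ _ k hB) ki.
Qed.

Lemma remainder_poly_over (R : realType) (S : subringClosed R) (n : nat)
    (beta : nat -> R) (i : nat) (x : R) (d : nat -> R) (m : nat) :
  (forall k, (k %% n).+1 != i -> beta k.+1 \in S) ->
  x \in S -> (forall k, d k.+1 \in S) ->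
  remainder_poly R n beta i x d m \is a polyOver S.
Proof.
move=> bS xS dS; elim: m => [|k IHk] /=; first by rewrite polyOverC.
rewrite rpredB ?polyOverC ?dS// rpredM//.
by case: ifPn => ki; rewrite ?polyOverX// polyOverC bS.
Qed.

Lemma remainder_poly_const (R : realType) (n : nat) (beta : nat -> R)
    (i : nat) (d r : nat -> R) (m : nat) :
  (forall k, r k.+1 = beta k.+1 * r k - d k.+1) ->
  (m < i <= n)%N -> remainder_poly R n beta i (r 0%N) d m = (r m)%:P.
Proof.
move=> hr; elim: m => [//|k IHk] /andP[ki in_]; rewrite /=.
rewrite modn_small ?(leq_trans _ in_) 1?ltnW//.
rewrite (ltn_eqF ki) IHk ?(ltnW ki)//.
by rewrite hr polyCB polyCM.
Qed.

(** A nonconstant polynomial absorbs the constant that is subtracted, so only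
the factor matters: a nonzero scalar or the indeterminate. *)
Lemma size_remainder_polyS (R : realType) (n : nat) (beta : nat -> R)
    (i : nat) (x : R) (d : nat -> R) (m : nat) :
  (forall k, beta k.+1 != 0) ->
  (1 < size (remainder_poly R n beta i x d m))%N ->
  size (remainder_poly R n beta i x d m.+1) =
    (((m %% n).+1 == i) + size (remainder_poly R n beta i x d m))%N.
Proof.
move=> b0 sm /=; set F := remainder_poly _ _ _ _ _ _ _ in sm *.
have F0 : F != 0 by rewrite -size_poly_gt0 (ltn_trans _ sm).
rewrite size_polyDl ?size_polyN; case: ifP => _.
- by rewrite mulrC size_mulX.
- by rewrite size_Cmul.
- by rewrite mulrC size_mulX// (leq_ltn_trans (size_polyC_leq1 _))// ltnW.
- by rewrite size_Cmul// (leq_ltn_trans (size_polyC_leq1 _)).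
Qed.

Lemma size_remainder_poly_homo (R : realType) (n : nat) (beta : nat -> R)
    (i : nat) (x : R) (d : nat -> R) (m j : nat) :
  (forall k, beta k.+1 != 0) ->
  (1 < size (remainder_poly R n beta i x d m))%N ->
  (size (remainder_poly R n beta i x d m) <=
     size (remainder_poly R n beta i x d (m + j)))%N.
Proof.
move=> b0 sm; elim: j => [|j IHj]; first by rewrite addn0.
rewrite addnS size_remainder_polyS// ?(leq_trans sm)//.
exact: leq_trans IHj (leq_addl _ _).
Qed.

(** The first indeterminate enters at step [i], as a factor of the constant
[r i.-1]; this is where the nonvanishing of that remainder is used. *)
Lemma size_remainder_poly_gt1 (R : realType) (n : nat) (beta : nat -> R)
    (i : nat) (d r : nat -> R) (m : nat) :
  (forall k, beta k.+1 != 0) ->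
  (forall k, r k.+1 = beta k.+1 * r k - d k.+1) ->
  (0 < i <= n)%N -> r i.-1 != 0 -> (i <= m)%N ->
  (1 < size (remainder_poly R n beta i (r 0%N) d m))%N.
Proof.
move=> b0 hr; case: i => [//|i] /= in_ ri im.
have s2 : size (remainder_poly R n beta i.+1 (r 0%N) d i.+1) = 2%N.
  rewrite /= modn_small// eqxx remainder_poly_const ?leqnn//.
  rewrite mulrC size_polyDl size_Cmul// size_polyX//.
  by rewrite size_polyN (leq_ltn_trans (size_polyC_leq1 _)).
rewrite -(subnKC im); apply: leq_trans (size_remainder_poly_homo _ _ _ _ _ _ _ _ b0 _).
  by rewrite s2.
by rewrite s2.
Qed.

(** * Periodic digits *)

Lemma base_prodS (R : realType) (beta : nat -> R) (m : nat) :
  base_prod beta m.+1 = base_prod beta m * beta m.+1.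
Proof. by rewrite /base_prod big_nat_recr. Qed.

Lemma unbounded_base_neq0 (R : realType) (beta : nat -> R) (k : nat) :
  `|base_prod beta m| @[m --> \oo] --> +oo -> beta k.+1 != 0.
Proof.
move=> /cvgryPgt /(_ 0) [N _ HN]; apply/eqP => bk.
have := HN (k.+1 + N)%N; rewrite /= leq_addl => /(_ isT).
suff -> : base_prod beta (k.+1 + N) = 0 by rewrite normr0 ltxx.
elim: N {HN} => [|N IHN]; first by rewrite addn0 base_prodS bk mulr0.
by rewrite addnS base_prodS IHN mul0r.
Qed.

(** A solution of the homogeneous recurrence is proportional to [base_prod beta],
so a nonzero one is unbounded. *)
Lemma bounded_linear_orbit_eq0 (R : realType) (beta e : nat -> R)
    (m : nat) (C : R) :
  `|base_prod beta k| @[k --> \oo] --> +oo ->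
  (forall k, (m <= k)%N -> e k.+1 = beta k.+1 * e k) ->
  (forall k, `|e k| <= C) ->
  e m = 0.
Proof.
move=> hlim he eC; apply/eqP/negPn/negP => em.
have eB j : base_prod beta m * e (m + j)%N = base_prod beta (m + j) * e m.
  elim: j => [|j IHj]; first by rewrite addn0.
  rewrite addnS he ?leq_addr// base_prodS mulrCA IHj; ring.
move/cvgryPgt: hlim => /(_ (`|base_prod beta m| * C / `|e m|)) [N _ HN].
have := HN (m + N)%N; rewrite /= leq_addl => /(_ isT).
rewrite ltr_pdivrMr ?normr_gt0// -normrM -eB normrM.
by rewrite ltNge ler_wpM2l.
Qed.

(** Stated for any bounded solution [r] of the digit recurrence, so that it
applies both to the expansion of a point and to the left limits of expansions
at [gamma + 1]. *)
Lemma algebraic_of_periodic_digits (R : realType) (S : subringClosed R)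
    (n : nat) (beta : nat -> R) (i : nat) (d r : nat -> R) (C : R) :
  alternate_base n beta ->
  `|base_prod beta m| @[m --> \oo] --> +oo ->
  (1 <= i <= n)%N ->
  (forall k, (k %% n).+1 != i -> beta k.+1 \in S) ->
  r 0%N \in S -> (forall k, d k.+1 \in S) ->
  (forall k, r k.+1 = beta k.+1 * r k - d k.+1) ->
  (forall k, `|r k| <= C) ->
  eventually_periodic d ->
  r i.-1 != 0 ->
  exists2 F : {poly R}, F != 0 & F \is a polyOver S /\ root F (beta i).
Proof.
move=> hB hlim /andP[i0 in_] bS rS dS hr rC [p p0 [N _ dN]] ri.
have n0 : (0 < n)%N := leq_trans i0 in_.
have b0 k : beta k.+1 != 0 by exact: unbounded_base_neq0.
have dP q m : (N <= m)%N -> d (m + q * p)%N = d m.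
  move=> Nm; elim: q => [|q IHq]; first by rewrite mul0n addn0.
  by rewrite mulSn [(p + _)%N]addnC addnA dN//= (leq_trans Nm) ?leq_addr.
have bP q k : beta (k + n * q).+1 = beta k.+1.
  have bm j := alternate_base_modn R n beta j hB.
  by rewrite bm [RHS]bm addnC mulnC modnMDl.
(* Step [m.+1] multiplies by the indeterminate, and comes after step [i] and
   after the preperiod of the digits. *)
pose m := (i.-1 + N.+1 * n)%N; pose P := (n * p)%N.
have Nm : (N <= m)%N.
  by rewrite /m (leq_trans (leqnSn N))// (leq_trans _ (leq_addl _ _))// leq_pmulr.
have im : (i <= m)%N.
  by rewrite /m -[leqLHS](prednK i0) -addn1 leq_add2l muln_gt0.
have P0 : (0 < P)%N by rewrite muln_gt0 n0.
have rmP : r (m + P)%N = r m.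
  apply/eqP; rewrite -subr_eq0; apply/eqP.
  apply: (bounded_linear_orbit_eq0 R beta (fun k => r (k + P)%N - r k) m (C + C)) => //.
    move=> k mk; rewrite addSn !hr bP -addSn dP; first ring.
    by rewrite (leq_trans Nm)// ltnW.
  by move=> k; rewrite (le_trans (ler_normB _ _))// lerD.
pose F := remainder_poly R n beta i (r 0%N) d.
exists (F (m + P)%N - F m); last split.
- suff : (size (F m) < size (F (m + P)%N))%N.
    by apply: contraTneq => /eqP; rewrite subr_eq0 => /eqP ->; rewrite ltnn.
  have Fm : (1 < size (F m))%N by apply: size_remainder_poly_gt1; rewrite ?i0.
  have mi : (m %% n).+1 = i.
    by rewrite /m addnC modnMDl modn_small ?prednK.
  have Fm1 := size_remainder_polyS R n beta i (r 0%N) d m b0 Fm.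
  rewrite mi eqxx in Fm1.
  rewrite -(prednK P0) addnS -addSn.
  apply: leq_trans (size_remainder_poly_homo _ _ _ _ _ _ _ _ b0 _).
    by rewrite Fm1.
  by rewrite Fm1 ltnW.
- by rewrite rpredB// remainder_poly_over.
- by rewrite rootE hornerD hornerN !horner_remainder_poly// rmP subrr.
Qed.

(** * Left limits of expansions at the endpoint *)

Lemma remainderS (R : realType) (gamma : R) (beta : nat -> R) (x : R) (k : nat) :
  remainder gamma beta x k.+1 =
    beta k.+1 * remainder gamma beta x k - (digit gamma beta x k.+1)%:~R.
Proof. by []. Qed.

Lemma remainder_itv (R : realType) (gamma : R) (beta : nat -> R) (x : R) (k : nat) :
  gamma <= x <= gamma + 1 -> gamma <= remainder gamma beta x k <= gamma + 1.
Proof.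
move=> hx; case: k => [//|k] /=.
set y := beta _ * _; have /andP[] := floor_itv (y - gamma).
by rewrite intrD => h1 h2; apply/andP; split; lra.
Qed.

(** For [c <= 0] the values approach [y] from above and the floor is that of
[y]; for [c > 0] they approach it strictly from below and the floor is
[ceil y - 1]. *)
Lemma floor_affine_near (R : realType) (y c : R) :
  exists z : int, \forall e \near (0 : R)^'+, Num.floor (y - c * e) = z.
Proof.
have c0 : 0 < `|c| + 1 by rewrite ltr_wpDl.
have [cle0|cgt0] := leP c 0.
  have /andP[fl fu] := floor_itv y.
  exists (Num.floor y); near=> e.
  have e0 : 0 < e by near: e; exact: nbhs_right_gt.
  have : e < ((Num.floor y + 1)%:~R - y) / (`|c| + 1).
    by near: e; apply: nbhs_right_lt; rewrite divr_gt0// subr_gt0.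
  rewrite ltr_pdivlMr// ler0_norm// => eu.
  by apply: floor_def; apply/andP; split; nra.
have /andP[fl fu] := ceil_itv y.
exists (Num.ceil y - 1); near=> e.
have e0 : 0 < e by near: e; exact: nbhs_right_gt.
have : e < (y - (Num.ceil y - 1)%:~R) / (`|c| + 1).
  by near: e; apply: nbhs_right_lt; rewrite divr_gt0// subr_gt0.
rewrite ltr_pdivlMr// gtr0_norm// => eu.
by apply: floor_def; rewrite subrK; apply/andP; split; nra.
Unshelve. all: by end_near. Qed.

Lemma affine_cvg_at_right0 (R : realType) (y c : R) :
  y - c * e @[e --> (0 : R)^'+] --> y.
Proof.
apply: cvg_at_right_filter; rewrite -[X in _ --> X]subr0 -[X in _ - X](mulr0 c).
by apply: cvgB; [exact: cvg_cst|apply: cvgM; [exact: cvg_cst|exact: cvg_id]].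
Qed.

(** By induction, the next digit is the floor of an affine function of [e], which
is constant near [0], so the next remainder is again affine. *)
Lemma remainder_left_affine (R : realType) (gamma : R) (beta : nat -> R) (m : nat) :
  exists y : R, \forall e \near (0 : R)^'+,
    remainder gamma beta (gamma + 1 - e) m = y - base_prod beta m * e.
Proof.
elim: m => [|m [y IHm]].
  exists (gamma + 1); near=> e.
  by rewrite /= /base_prod big_geq// mul1r.
have [z Hz] := floor_affine_near R (beta m.+1 * y - gamma) (base_prod beta m.+1).
exists (beta m.+1 * y - z%:~R); near=> e.
have He : remainder gamma beta (gamma + 1 - e) m = y - base_prod beta m * e.
  by near: e.
have Fe : Num.floor (beta m.+1 * y - gamma - base_prod beta m.+1 * e) = z.
  by near: e.
rewrite /= He.
have -> : beta m.+1 * (y - base_prod beta m * e) - gamma =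
    beta m.+1 * y - gamma - base_prod beta m.+1 * e.
  by rewrite base_prodS; ring.
by rewrite Fe base_prodS; ring.
Unshelve. all: by end_near. Qed.

Lemma remainder_star_near (R : realType) (gamma : R) (beta : nat -> R) (m : nat) :
  \forall e \near (0 : R)^'+,
    remainder gamma beta (gamma + 1 - e) m =
      remainder_star gamma beta m - base_prod beta m * e.
Proof.
have [y Hy] := remainder_left_affine R gamma beta m.
suff -> : remainder_star gamma beta m = y by [].
apply: cvg_lim => //.
apply: cvg_trans (affine_cvg_at_right0 R y (base_prod beta m)).
by apply: near_eq_cvg; apply: filterS Hy => e ->.
Qed.

Lemma remainder_star0 (R : realType) (gamma : R) (beta : nat -> R) :
  remainder_star gamma beta 0 = gamma + 1.
Proof.
apply: cvg_lim => //=; under eq_fun do rewrite -[X in _ - X]mul1r.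
exact: affine_cvg_at_right0.
Qed.

(** The limit of the digits is their common value near [0], hence an
integer. *)
Lemma digit_star_near (R : realType) (gamma : R) (beta : nat -> R) (k : nat) :
  exists z : int,
    digit_star gamma beta k.+1 = z%:~R /\
    \forall e \near (0 : R)^'+, digit gamma beta (gamma + 1 - e) k.+1 = z.
Proof.
have [z Hz] := floor_affine_near R
  (beta k.+1 * remainder_star gamma beta k - gamma) (base_prod beta k.+1).
have Dz : \forall e \near (0 : R)^'+, digit gamma beta (gamma + 1 - e) k.+1 = z.
  near=> e.
  have He : remainder gamma beta (gamma + 1 - e) k =
      remainder_star gamma beta k - base_prod beta k * e.
    by near: e; exact: remainder_star_near.
  rewrite /digit /= He.
  have -> : beta k.+1 * (remainder_star gamma beta k - base_prod beta k * e) - gamma =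
      beta k.+1 * remainder_star gamma beta k - gamma - base_prod beta k.+1 * e.
    by rewrite base_prodS; ring.
  by near: e.
exists z; split => //.
by apply: cvg_lim => //; apply: cvg_near_cst; apply: filterS Dz => e ->.
Unshelve. all: by end_near. Qed.

Lemma remainder_starS (R : realType) (gamma : R) (beta : nat -> R) (k : nat) :
  remainder_star gamma beta k.+1 =
    beta k.+1 * remainder_star gamma beta k - digit_star gamma beta k.+1.
Proof.
have [z [-> Dz]] := digit_star_near R gamma beta k.
near (0 : R)^'+ => e.
have H0 : remainder gamma beta (gamma + 1 - e) k =
    remainder_star gamma beta k - base_prod beta k * e.
  by near: e; exact: remainder_star_near.
have H1 : remainder gamma beta (gamma + 1 - e) k.+1 =
    remainder_star gamma beta k.+1 - base_prod beta k.+1 * e.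
  by near: e; exact: remainder_star_near.
have De : digit gamma beta (gamma + 1 - e) k.+1 = z by near: e.
move: H1; rewrite remainderS De H0 base_prodS => H1.
by apply: (addIr (- (base_prod beta k * beta k.+1 * e))); rewrite -H1; ring.
Unshelve. all: by end_near. Qed.

Lemma remainder_star_itv (R : realType) (gamma : R) (beta : nat -> R) (k : nat) :
  gamma <= remainder_star gamma beta k <= gamma + 1.
Proof.
have cv : remainder gamma beta (gamma + 1 - e) k @[e --> (0 : R)^'+] -->
    remainder_star gamma beta k.
  apply: cvg_trans (affine_cvg_at_right0 R _ (base_prod beta k)).
  by apply: near_eq_cvg; apply: filterS (remainder_star_near R gamma beta k) => e ->.
have itv : \forall e \near (0 : R)^'+,
    gamma <= remainder gamma beta (gamma + 1 - e) k <= gamma + 1.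
  near=> e; apply: remainder_itv.
  have e0 : 0 < e by near: e; exact: nbhs_right_gt.
  have e1 : e < 1 by near: e; exact: nbhs_right_lt.
  by apply/andP; split; lra.
apply/andP; split.
- by apply: (cvgr_to_ge cv); apply: filterS itv => e /andP[].
- by apply: (cvgr_to_le cv); apply: filterS itv => e /andP[].
Unshelve. all: by end_near. Qed.

(** * Algebraicity of a base element *)

Theorem proposition2p1 (R : realType) (gamma : R) (n : nat) (beta : nat -> R)
  (hB : alternate_base n beta)
  (hlim : `|base_prod beta m| @[m --> \oo] --> +oo)
  (i : nat) (hi : (1 <= i <= n)%N)
  (x : R) (hxK : x \in base_field n beta i) (hx : gamma <= x <= gamma + 1)
  (hper :
    (eventually_periodic (digit gamma beta x) /\
       remainder gamma beta x i.-1 != 0) \/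
    (x = gamma + 1 /\
       eventually_periodic (digit_star gamma beta) /\
       remainder_star gamma beta i.-1 != 0)) :
  algebraic_over (base_field n beta i) (beta i).
Proof.
have norm_itv (y : R) : gamma <= y <= gamma + 1 -> `|y| <= `|gamma| + 1.
  by move=> /andP[? ?]; rewrite ler_norml; have := ler_norm gamma;
     have := ler_norm (- gamma); rewrite normrN => ? ?; apply/andP; split; lra.
pose K := generated_subfield_pred R
  [set beta j | j in [set j | (1 <= j <= n)%N && (j != i)]].
have intK (z : int) : z%:~R \in K by rewrite rpred_int.
have bK k : (k %% n).+1 != i -> beta k.+1 \in K.
  by apply: base_in_base_field => //; case/andP: hi; exact: leq_trans.
case: hper => [[[p p0 Hp] ri]|[x1 [Hp ri]]].
- apply: (algebraic_of_periodic_digits R K n beta i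
    (fun k => (digit gamma beta x k)%:~R) (remainder gamma beta x)
    (`|gamma| + 1)) => // [k|].
    exact/norm_itv/remainder_itv.
  by exists p => //; apply: filterS Hp => k ->.
- apply: (algebraic_of_periodic_digits R K n beta i
    (digit_star gamma beta) (remainder_star gamma beta)
    (`|gamma| + 1)) => //.
  + by rewrite remainder_star0 -x1.
  + by move=> k; have [z [-> _]] := digit_star_near R gamma beta k.
  + exact: remainder_starS.
  + by move=> k; exact/norm_itv/remainder_star_itv.
Qed.
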